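(* Let $\mathcal{T}$ be a tree chosen uniformly at random from the $n^{n-2}$ labelled trees on the vertex set $[n]=\{1,\dots,n\}$, and let $c(n)$ denote the number of sub-trees of $\mathcal{T}$. Then asymptotically almost surely $c(n) \ge 1.37135^n$.
   Context: A sub-tree of a tree $T$ is a subgraph of $T$ that is itself a tree, equivalently a non-empty vertex subset of $T$ inducing a connected subgraph. An event holds asymptotically almost surely (a.a.s.) if its probability tends to $1$ as $n\to\infty$. *)

(* Defs.v *)
From mathcomp Require Import all_boot all_order all_algebra.
From mathcomp Require Import boolp classical_sets reals topology normedtype sequences.

Set Implicit Arguments.
Unset Strict Implicit.
Unset Printing Implicit Defensive.

Import Order.TTheory GRing.Theory Num.Theory.
Import numFieldNormedType.Exports.

Local Open Scope ring_scope.

(* A finite simple graph is a pair (V, E) of a vertex set V and an edge set E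
   whose members are two-element subsets of V.  The same predicate [is_tree]
   is used for the random tree and for its sub-trees. *)
Section Trees.
Variable T : finType.
Implicit Types (V : {set T}) (E : {set {set T}}).

Definition is_graph V E : bool :=
  [forall e in E, (e \subset V) && (#|e| == 2%N)].

Definition adj E : rel T := fun x y => [set x; y]%SET \in E.

Definition graph_connected V E : bool :=
  (0 < #|V|)%N && [forall x in V, forall y in V, connect (adj E) x y].

(* [ucycle] also accepts x, y, x along a single edge: hence the length bound. *)
Definition acyclic E : Prop :=
  forall c : seq T, (2 < size c)%N -> ~ ucycle (adj E) c.

Definition is_tree V E : Prop :=
  [/\ is_graph V E, graph_connected V E & acyclic E].

(* E is the edge set of a graph whose vertex set is the whole of T, so a
   subgraph H only has to satisfy H.2 \subset E. *)
Definition subtrees E : {set {set T} * {set {set T}}} :=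
  [set H : {set T} * {set {set T}} |
    (H.2 \subset E) && `[< is_tree H.1 H.2 >]]%SET.

End Trees.

(* Edge sets of the trees whose vertex set is all of 'I_n. *)
Definition labelled_trees (n : nat) : {set {set {set 'I_n}}} :=
  [set E | `[< is_tree [set: 'I_n]%SET E >]]%SET.

Definition uniform_prob (R : realType) (X : finType) (A : {set X})
  (P : pred X) : R := #|[set x in A | P x]%SET|%:R / #|A|%:R.

Definition aas (R : realType) (X : nat -> finType)
  (A : forall n, {set X n}) (P : forall n, pred (X n)) : Prop :=
  (uniform_prob R (A n) (P n) @[n --> \oo] --> (1 : R))%classic.

(* The number 1.37135, written digit by digit: nat literals such as 137135
   and 100000 are too large for unary computation. *)
Definition dec_1_37135 (R : realType) : R :=
  1 + 3%:R / 10%:R + 7%:R / 10%:R ^+ 2 + 1 / 10%:R ^+ 3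
    + 3%:R / 10%:R ^+ 4 + 5%:R / 10%:R ^+ 5.

(* Main.v *)
Require Import Defs.
From mathcomp Require Import all_boot zify boolp.

(** Root the tree at a fixed vertex and call a path [v_1, ..., v_j] pendant if it
is the whole subtree hanging below [v_j].  If [N_j] vertices start a pendant path
with [j] vertices, then trimming these paths from below, independently for each
leaf, yields at least [2^N_1 (3/2)^N_2 (4/3)^N_3] sub-trees containing the root.

Rooted trees are parent maps.  The forests on [a] vertices hanging from [r] roots
number [r (a + r)^(a - 1)], by recursion on the set of children of the roots.
Deleting one or two pendant paths from a tree leaves such a forest, so the first
two moments of [N_j] are explicit: the mean is asymptotically [n / e^j] and the
variance is [O(n)].  By Chebyshev's inequality a.a.s. [30 N_1 >= 11 n],
[30 N_2 >= 4 n] and [30 N_3 >= n], and [2^11 (3/2)^4 (4/3) = 24^3] exceeds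
[1.37135^30]. *)

Set Implicit Arguments.
Unset Strict Implicit.
Unset Printing Implicit Defensive.

(** * Forests as parent maps *)

Section Forests.
Variables (T : finType) (x0 : T).
Implicit Types (A B D R S : {set T}) (f g h : {ffun T -> T}) (v w : seq T).

(* A forest on [A] hanging from the root set [R], given by its parent map: the
   absence of a nonempty subset of [A] stable under [f] says that iterating [f]
   leads every vertex of [A] into [R].  Outside [A] the parent map takes the
   junk value [x0]. *)
Definition forest A R : {set {ffun T -> T}} :=
  [set f | (f \in pffun_on x0 A (A :|: R)) &&
    [forall S : {set T}, (S \subset A) ==> (f @: S \subset S) ==> (S == set0)]].

Lemma forestP A R f :
  reflect [/\ forall x, x \notin A -> f x = x0,
              forall x, x \in A -> f x \in A :|: R &
              forall S, S \subset A -> (forall x, x \in S -> f x \in S) -> S = set0]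
    (f \in forest A R).
Proof.
rewrite inE; apply: (iffP andP) => [[/pffun_onP[sA fA] /forallP fS]|[sA fA fS]].
  split=> [x xA|x xA|S SA clS].
  - apply: contraNeq xA => fx; apply: (subsetP sA); exact: fx.
  - by apply: fA; apply: image_f.
  - have /implyP/(_ SA)/implyP := fS S; move=> H; apply/eqP/H.
    by apply/subsetP=> _ /imsetP[x xS ->]; apply: clS.
split.
  apply/pffun_onP; split.
    apply/subsetP=> x; rewrite inE => fx; apply: contraNT fx => xA.
    by rewrite sA.
  by move=> _ /imageP[x xA ->]; apply: fA.
apply/forallP=> S; apply/implyP=> SA; apply/implyP=> /subsetP clS.
by apply/eqP/fS => // x xS; apply: clS; apply: imset_f.
Qed.

Lemma forest_supp A R f x : f \in forest A R -> x \notin A -> f x = x0.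
Proof. by case/forestP=> H _ _ /H. Qed.

Lemma disjointDl (A V : {set T}) : [disjoint A :\: V & V].
Proof. by rewrite disjoints_subset; apply/subsetP=> x; rewrite !inE => /andP[]. Qed.

Lemma setDUK (A V : {set T}) : V \subset A -> A :\: V :|: V = A.
Proof.
move=> VA; apply/setP=> x; rewrite !inE.
by case: (boolP (x \in V)) => [/(subsetP VA)->|]; rewrite ?orbF.
Qed.

(** * Gluing parent maps along disjoint domains, and the number of forests *)

Definition restrict D f : {ffun T -> T} :=
  [ffun x => if x \in D then f x else x0].

Lemma restrictE D f x : restrict D f x = if x \in D then f x else x0.
Proof. by rewrite ffunE. Qed.

(** A map supported on [D1 :|: D2] amounts to a pair of maps, one on each part; the support
    conditions on [X] and [Y] make every pair occur. *)
Lemma card_glue D1 D2 (X Y : {set {ffun T -> T}}) :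
  [disjoint D1 & D2] ->
  (forall f x, f \in X -> x \notin D1 -> f x = x0) ->
  (forall f x, f \in Y -> x \notin D2 -> f x = x0) ->
  #|[set f : {ffun T -> T} | [forall x, (x \notin D1 :|: D2) ==> (f x == x0)]
             & (restrict D1 f \in X) && (restrict D2 f \in Y)]| = #|X| * #|Y|.
Proof.
move=> dis sX sY; rewrite -cardsX.
set G := [set f | _].
have <- : [set (restrict D1 f, restrict D2 f) | f in G] = setX X Y.
  apply/setP=> -[g h]; apply/imsetP/setXP => [[f fG [-> ->]]|[gX hY]].
    by move: fG; rewrite inE => /andP[_ /andP[]].
  pose f := [ffun x => if x \in D1 then g x else if x \in D2 then h x else x0].
  have e1 : restrict D1 f = g.
    apply/ffunP=> x; rewrite !ffunE; have [//|xD] := boolP (x \in D1).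
    by rewrite (sX g).
  have e2 : restrict D2 f = h.
    apply/ffunP=> x; rewrite !ffunE; have [xD|xD] := boolP (x \in D2); last first.
      by rewrite (sY h).
    by rewrite (disjointFl dis xD).
  exists f; last by rewrite e1 e2.
  rewrite inE e1 e2 gX hY !andbT; apply/forallP=> x; apply/implyP.
  by rewrite inE negb_or ffunE => /andP[/negbTE-> /negbTE->].
rewrite card_in_imset // => f g; rewrite !inE.
move=> /andP[/forallP sf _] /andP[/forallP sg _] [/ffunP e1 /ffunP e2].
apply/ffunP=> x; have [xD1|xD1] := boolP (x \in D1).
  by move: (e1 x); rewrite !ffunE xD1.
have [xD2|xD2] := boolP (x \in D2).
  by move: (e2 x); rewrite !ffunE xD2.
have xD : x \notin D1 :|: D2 by rewrite inE negb_or xD1.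
by move: (sf x) (sg x); rewrite xD /= => /eqP-> /eqP->.
Qed.

(** [B] is the set of children of the roots. The other vertices form a forest hanging from [B], and
    each vertex of [B] picks its root freely. *)
Lemma forest_layer A R B : [disjoint A & R] -> B \subset A ->
  #|[set f : {ffun T -> T} in forest A R | [set x in A | f x \in R] == B]| =
  #|forest (A :\: B) B| * #|R| ^ #|B|.
Proof.
move=> dAR BA.
rewrite -(card_pffun_on x0 (mem B) (mem R)) -[X in _ * X]cardsE.
rewrite -(@card_glue (A :\: B) B); first last.
- move=> f x; rewrite inE => /pffun_onP[sB _] xB; apply: contraNeq xB => fx.
  by apply: (subsetP sB); exact: fx.
- exact: forest_supp.
- exact: disjointDl.
have AB := setDUK BA.
rewrite AB; congr #|pred_of_set _|; apply/setP=> f.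
rewrite [LHS]in_set [RHS]in_set [_ \in [set f in pffun_on _ _ _]]in_set.
apply/andP/and3P => [[/forestP[sA fA fS] /eqP eB]|[/forallP sA /forestP[_ fA fS] /pffun_onP[_ fB]]].
  have inB x : x \in A -> (x \in B) = (f x \in R) by move=> xA; rewrite -eB inE xA.
  split.
  - by apply/forallP=> x; apply/implyP=> xA; rewrite sA.
  - apply/forestP; split=> [x /negbTE xA|x xAB|S SA clS].
    + by rewrite restrictE xA.
    + rewrite restrictE xAB AB; move: xAB; rewrite inE => /andP[xB xA].
      by move: (fA x xA); rewrite inE -inB // (negbTE xB) orbF.
    + apply: fS => [|x xS]; first by apply: subset_trans SA (subsetDl _ _).
      by move: (clS x xS); rewrite restrictE (subsetP SA).
  - apply/pffun_onP; split.
      apply/subsetP=> x; rewrite inE restrictE.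
      by case: ifP => //; rewrite eqxx.
    move=> _ /imageP[x xB ->]; rewrite restrictE xB.
    by rewrite -inB // (subsetP BA).
have fB' x : x \in B -> f x \in R.
  move=> xB; have := fB _ (image_f (restrict B f) xB).
  by rewrite restrictE xB.
have fA' x : x \in A -> x \notin B -> f x \in A.
  move=> xA xB; have xAB : x \in A :\: B by rewrite inE xB.
  by move: (fA x xAB); rewrite restrictE xAB AB.
split.
  apply/forestP; split=> [x xA|x xA|S SA clS].
  - by apply/eqP; move: (sA x); rewrite xA.
  - rewrite inE; case: (boolP (x \in B)) => [/fB' ->|/(fA' _ xA)->//].
    by rewrite orbT.
  - have SAB : S \subset A :\: B.
      apply/subsetP=> x xS; rewrite inE (subsetP SA) // andbT.
      apply: contraTN dAR => xB; apply/pred0Pn; exists (f x) => /=.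
      by rewrite fB' // (subsetP SA) ?clS.
    apply: fS => // x xS; rewrite restrictE (subsetP SAB) //; exact: clS.
apply/eqP/setP=> x; rewrite inE.
case: (boolP (x \in B)) => [xB|xB]; first by rewrite fB' // (subsetP BA).
apply/negP=> /andP[xA fxR]; have := fA' x xA xB.
by rewrite (disjointFl dAR fxR).
Qed.

Lemma forest_set0 A : A != set0 -> forest A set0 = set0.
Proof.
move=> A0; apply/setP=> f; rewrite [RHS]inE; apply/negP => /forestP[_ fA fS].
move/eqP: A0; apply; apply: fS => // x /fA; by rewrite setU0.
Qed.

Lemma sum_subsets_card A (F : nat -> nat) :
  \sum_(B : {set T} | B \subset A) F #|B| = \sum_(k < #|A|.+1) 'C(#|A|, k) * F k.
Proof.
pose cd (B : {set T}) : 'I_#|A|.+1 := inord #|B|.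
rewrite (partition_big cd predT) //=; apply: eq_bigr => k _.
rewrite -cards_draws -[X in X * _]sum1_card big_distrl /=.
apply: eq_big => [B|B].
  rewrite inE; case: (boolP (B \subset A)) => //= BA.
  by rewrite -val_eqE /= inordK // ltnS subset_leq_card.
by move=> /andP[BA /eqP <-]; rewrite mul1n /= inordK // ltnS subset_leq_card.
Qed.

(** The identity [k * 'C(a.+1, k) = a.+1 * 'C(a, k.-1)] turns the sum into the binomial expansion of
    [(a.+1 + r) ^ a]. *)
Lemma sum_binomial_weighted a r :
  \sum_(k < a.+2) 'C(a.+1, k) * (r ^ k * (k * a.+1 ^ (a.+1 - k))) =
  a.+1 * (r * (a.+1 + r) ^ a).
Proof.
rewrite big_ord_recl /= !mul0n !muln0 add0n expnDn !big_distrr /=.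
apply: eq_bigr => k _; rewrite /bump /= add1n subSS.
rewrite expnS; move: (r ^ k) (a.+1 ^ _) => u y.
transitivity (k.+1 * 'C(a.+1, k.+1) * (r * u * y)); first by lia.
by rewrite -mul_bin_diag /=; lia.
Qed.

(** Cayley's formula for rooted forests, multiplied out so that an empty [A] is covered. Forests are
    sorted by the set [B] of children of the roots, and induction counts those on [A :\: B] hanging
    from [B]. *)
Theorem card_forest A R : [disjoint A & R] ->
  #|forest A R| * (#|A| + #|R|) = #|R| * (#|A| + #|R|) ^ #|A|.
Proof.
have [m] := ubnP #|A|; elim: m A R => // m IH A R; rewrite ltnS => Am dAR.
have [->|A0] := eqVneq A set0.
  rewrite cards0 expn0 add0n muln1.
  suff -> : forest set0 R = [set [ffun=> x0]] by rewrite cards1 mul1n.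
  apply/setP=> f; rewrite in_set1; apply/forestP/eqP => [[s _ _]|->].
    by apply/ffunP=> x; rewrite ffunE s // inE.
  split=> [x _|x|S]; rewrite ?ffunE ?inE //.
  by rewrite subset0 => /eqP.
(* The factor [#|A|] is the one in the induction hypothesis, since [#|A :\: B| + #|B| = #|A|]. *)
have e : #|forest A R| * #|A| =
         \sum_(B : {set T} | B \subset A) #|R| ^ #|B| * (#|B| * #|A| ^ (#|A| - #|B|)).
  rewrite -sum1_card (partition_big (fun f : {ffun T -> T} => [set x in A | f x \in R])
            (fun B => B \subset A)) /=; last first.
    by move=> f _; apply/subsetP=> x; rewrite inE => /andP[].
  rewrite big_distrl /=; apply: eq_bigr => B BA.
  transitivity (#|[set f : {ffun T -> T} in forest A R | [set x in A | f x \in R] == B]| * #|A|).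
    by congr (_ * _); rewrite -sum1_card; apply: eq_bigl => f; rewrite [RHS]in_set.
  rewrite forest_layer // [_ * #|R| ^ _]mulnC -mulnA; congr (_ * _).
  have [->|B0] := eqVneq B set0.
    by rewrite setD0 forest_set0 // !cards0.
  have cA : #|A| = #|A :\: B| + #|B|.
    by rewrite -(cardsID B A) (setIidPr BA) addnC.
  have := IH (A :\: B) B; rewrite -cA cardsD (setIidPr BA); apply.
    apply: leq_trans Am; rewrite -subn_gt0 subKn ?subset_leq_card ?card_gt0 //.
  exact: disjointDl.
have A1 : 0 < #|A| by rewrite card_gt0.
move: e; rewrite (sum_subsets_card A (fun k => #|R| ^ k * (k * #|A| ^ (#|A| - k)))).
case: #|A| A1 => // a _; rewrite sum_binomial_weighted mulnC => /eqP.
rewrite eqn_pmul2l // => /eqP->.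
by rewrite expnSr mulnA.
Qed.

(** * Depth of a vertex, and pendant paths *)

Lemma forest_depth A R f : f \in forest A R ->
  exists d : T -> nat, forall x, x \in A -> d (f x) < d x.
Proof.
case/forestP=> _ _ fS.
(* An orbit that never left [A] would be a nonempty stable subset of [A]. The depth is the number of
   steps needed to leave [A]. *)
have ex x : exists k, iter k f x \notin A.
  case: (boolP [exists y in orbit f x, y \notin A]) => [|].
    case/exists_inP=> y; rewrite -fconnect_orbit => xy yA.
    by exists (findex f x y); rewrite iter_findex.
  rewrite negb_exists_in => /forall_inP xA.
  have /setP/(_ x) : [set y in orbit f x] = set0.
    apply: fS => [|y]; first by apply/subsetP=> y; rewrite inE => /xA; rewrite negbK.
    by rewrite !inE -!fconnect_orbit => xy; apply: connect_trans xy (fconnect1 _ _).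
  by rewrite !inE -fconnect_orbit connect0.
exists (fun x => ex_minn (ex x)) => x xA.
case: ex_minnP => k _ kmin; case: ex_minnP => m mA _.
case: m mA => [|m]; first by rewrite /= xA.
by rewrite iterSr => mA; rewrite ltnS kmin.
Qed.

Lemma traject_depth A f (d : T -> nat) x j a b :
  (forall y, y \in A -> d (f y) < d y) -> {subset traject f x j <= A} ->
  a < b -> b <= j -> d (iter b f x) < d (iter a f x).
Proof.
move=> dA sA; elim: b => // b IH; rewrite ltnS leq_eqVlt => ab bj.
have bA : iter b f x \in A by apply: sA; apply/trajectP; exists b.
case/predU1P: ab => [->|ab]; first exact: dA.
by apply: ltn_trans (dA _ bA) (IH ab (ltnW bj)).
Qed.

(* [v] lists a pendant path from its leaf upwards; the last condition says that
   nothing else hangs from it. *)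
Definition pendant A f v :=
  [&& all (mem A) v, sorted (frel f) v & [forall y, (f y \in v) ==> (y \in v)]].

Lemma pendantP A f v :
  reflect [/\ {subset v <= A}, sorted (frel f) v & forall y, f y \in v -> y \in v]
          (pendant A f v).
Proof.
apply: (iffP and3P) => [[/allP sA sv /forallP pv]|[sA sv pv]].
  by split=> // y; apply/implyP/pv.
by split=> //; [apply/allP | apply/forallP=> y; apply/implyP/pv].
Qed.

Lemma last_in v : 0 < size v -> last x0 v \in v.
Proof. by case: v => // x s _; rewrite /= mem_last. Qed.

Lemma sorted_frelE f v : sorted (frel f) v -> v = traject f (head x0 v) (size v).
Proof. by case: v => //= x p /fpathP[m ->]; rewrite size_traject. Qed.

(* Walking both paths down from a common vertex ends at a common leaf. *)
Lemma pendant_index A R f x y j k a b : f \in forest A R ->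
  pendant A f (traject f x j) -> pendant A f (traject f y k) ->
  a < j -> b < k -> iter a f x = iter b f y -> x = y /\ a = b.
Proof.
move=> fF; have [d dA] := forest_depth fF.
wlog leab : x y j k a b / a <= b => [H px py aj bk e|].
  case: (leqP a b) => [ab|/ltnW ab]; first exact: (H x y j k a b ab).
  by have [-> ->] := H y x k j b a ab py px bk aj (esym e).
move=> /pendantP[xA _ pre] _ aj _ e.
have inj i l : i <= j -> l <= j -> iter i f x = iter l f x -> i = l.
  move=> ij lj il; case: (ltngtP i l) => // H.
    by have := traject_depth dA xA H lj; rewrite il ltnn.
  by have := traject_depth dA xA H ij; rewrite il ltnn.
have back i l : i.+1 < j -> iter i.+1 f x = iter l.+1 f y -> iter i f x = iter l f y.
  move=> ij il; have /trajectP[m mj me] : iter l f y \in traject f x j.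
    by apply: pre; rewrite -iterS -il; apply/trajectP; exists i.+1.
  have e' : iter i.+1 f x = iter m.+1 f x by rewrite il /= me.
  by have [->] := inj _ _ (ltnW ij) mj e'.
have xe : x = iter (b - a) f y.
  elim: a b leab aj e => [|a IH] [|b] //; rewrite ltnS => ab aj e.
  by rewrite subSS; apply: IH => //; [apply: ltnW | apply: back].
(* If [a < b], then [x] has a child [iter c f y], which pendancy puts on the path above [x]; the
   strict decrease of depth excludes this. *)
case: (posnP (b - a)) => [ba0|]; first by rewrite xe ba0; split=> //; lia.
case: (b - a) xe => // c xe _.
have j0 : 0 < j by apply: leq_ltn_trans aj.
have /trajectP[m mj me] : iter c f y \in traject f x j.
  by apply: pre; rewrite -iterS -xe; apply/trajectP; exists 0.
have e' : iter 0 f x = iter m.+1 f x by rewrite /= -me.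
by have := inj 0 m.+1 (leq0n _) mj e'.
Qed.

(** By [pendant_index], paths that meet start at the same leaf; having the same length, they
    coincide. *)
Lemma pendant_disjoint A R f v w : f \in forest A R ->
  pendant A f v -> pendant A f w -> size v = size w -> v != w ->
  [disjoint v & w].
Proof.
move=> fF pv pw s; apply: contraNT => /pred0Pn[z /= /andP[zv zw]].
have /pendantP[_ /sorted_frelE ev _] := pv.
have /pendantP[_ /sorted_frelE ew _] := pw.
move: zv zw pv pw; rewrite ev ew s.
move=> /trajectP[a aj ->] /trajectP[b bj e] pv pw.
by have [-> _] := pendant_index fF pv pw aj bj e.
Qed.

(** * Counting forests with one or two prescribed pendant paths *)

Definition tail_maps v (M : {set T}) : {set {ffun T -> T}} :=
  [set h : {ffun T -> T} | [&& [forall x, (x \notin v) ==> (h x == x0)],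
     sorted (frel h) v & h (last x0 v) \in M]].

(** Sortedness forces the map at every vertex of [v] but the last, whose image ranges freely over
    [M]. *)
Lemma card_tail_maps v M : uniq v -> 0 < size v -> #|tail_maps v M| = #|M|.
Proof.
move=> uv v0.
pose h m : {ffun T -> T} :=
  [ffun x => if x \in v then nth x0 (rcons v m) (index x v).+1 else x0].
have lv := last_in v0.
have hl m : h m (last x0 v) = m.
  by rewrite ffunE lv -nth_last index_uniq ?prednK // nth_rcons ltnn eqxx.
rewrite -(card_imset M (f := h)); last first.
  by move=> m m' e; rewrite -(hl m) e hl.
congr #|pred_of_set _|; apply/setP=> g; rewrite inE.
apply/and3P/imsetP => [[/forallP gv sg gM]|[m mM ->]].
  exists (g (last x0 v)) => //; apply/ffunP=> x; rewrite ffunE.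
  case: ifP => [xv|/negbT xv]; last by apply/eqP; move: (gv x); rewrite xv.
  have iv : index x v < size v by rewrite index_mem.
  rewrite nth_rcons; case: ltnP => [lt|ge].
    by have /sortedP/(_ _ lt)/eqP <- := sg; rewrite nth_index.
  have e : (index x v).+1 = size v by apply/eqP; rewrite eqn_leq iv.
  by rewrite e eqxx -nth_last -e /= nth_index.
split; last by rewrite hl.
  by apply/forallP=> x; apply/implyP=> /negbTE xv; rewrite ffunE xv.
apply/(sortedP x0) => i iv; apply/eqP; rewrite ffunE mem_nth ?(ltnW iv) //.
by rewrite index_uniq ?(ltnW iv) // nth_rcons iv.
Qed.

Lemma tail_maps_supp v (M : {set T}) f x :
  f \in tail_maps v M -> x \notin [set z in v] -> f x = x0.
Proof.
by rewrite !inE => /and3P[/forallP H _ _] xv; apply/eqP; move: (H x); rewrite xv.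
Qed.

Lemma sorted_restrict D f v : {subset v <= D} ->
  sorted (frel (restrict D f)) v = sorted (frel f) v.
Proof.
move=> vD; apply: eq_in_sorted (allss v) => x y /= /vD xD _.
by rewrite restrictE xD.
Qed.

Lemma pendant_last A R f v : f \in forest A R -> pendant A f v -> 0 < size v ->
  f (last x0 v) \notin v.
Proof.
move=> fF /pendantP[vA sv _] v0; have [d dA] := forest_depth fF.
have ev := sorted_frelE sv; move: vA v0; rewrite ev size_traject.
case: (size v) => // j vA _; rewrite /= last_traject -iterS -/(traject f _ j.+1).
apply/negP=> /trajectP[i ij ie].
by have := traject_depth dA vA ij (leqnn _); rewrite ie ltnn.
Qed.

Lemma forest_restrict A R f v : f \in forest A R -> pendant A f v ->
  restrict (A :\: [set z in v]) f \in forest (A :\: [set z in v]) R.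
Proof.
move=> /forestP[sA fA fS] /pendantP[vA sv pv].
apply/forestP; split=> [x /negbTE xA|x xA|S SA clS].
- by rewrite restrictE xA.
- rewrite restrictE xA; move: xA; rewrite !inE => /andP[xv xA].
  rewrite (contra (pv x) xv) /=; by have := fA x xA; rewrite inE.
- apply: fS => [|x xS]; first exact: subset_trans SA (subsetDl _ _).
  by move: (clS x xS); rewrite restrictE (subsetP SA).
Qed.

Lemma restrict_tail A R f v (M : {set T}) : f \in forest A R -> pendant A f v ->
  0 < size v -> f (last x0 v) \in M -> restrict [set z in v] f \in tail_maps v M.
Proof.
move=> fF /pendantP[vA sv pv] v0 lM; rewrite inE; apply/and3P; split.
- by apply/forallP=> x; apply/implyP=> /negbTE xv; rewrite restrictE inE xv.
- by rewrite sorted_restrict // => x; rewrite inE.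
- by rewrite restrictE inE last_in.
Qed.

(* Deleting the path leaves an arbitrary forest on [A \ v], and its top may hang
   from any of the remaining vertices. *)
Lemma card_pendant A R v : [disjoint A & R] -> x0 \notin A -> uniq v ->
  0 < size v -> {subset v <= A} ->
  #|[set f in forest A R | pendant A f v]| =
  #|forest (A :\: [set z in v]) R| * (#|A| + #|R| - size v).
Proof.
move=> dAR x0A uv v0 vA; set V := [set z in v].
have VA : V \subset A by apply/subsetP=> z; rewrite inE => /vA.
have cV : #|V| = size v by rewrite cardsE; apply/card_uniqP.
have cM : #|(A :|: R) :\: V| = #|A| + #|R| - size v.
  rewrite cardsD (setIidPr _) ?cV; last exact: subset_trans VA (subsetUl _ _).
  by rewrite cardsU (_ : A :&: R = set0) ?cards0 ?subn0 //; apply/eqP; rewrite setI_eq0.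
rewrite -cM -(card_tail_maps ((A :|: R) :\: V) uv v0).
rewrite -(@card_glue (A :\: V) V); first last.
- exact: tail_maps_supp.
- exact: forest_supp.
- exact: disjointDl.
congr #|pred_of_set _|; apply/setP=> f; rewrite [LHS]in_set [RHS]in_set setDUK //.
apply/andP/and3P => [[fF pv]|[/forallP sf fF tF]].
  split; first by apply/forallP=> x; apply/implyP=> xA; rewrite (forest_supp fF).
    exact: forest_restrict.
  apply: (restrict_tail fF pv v0); rewrite inE inE (pendant_last fF pv v0).
  case/forestP: fF => _ fA _; apply: fA; apply: vA.
  exact: last_in.
move: (tF); rewrite in_set sorted_restrict => [/and3P[_ sv]|]; last by move=> x; rewrite inE.
have lv : last x0 v \in V by rewrite inE last_in.
rewrite restrictE lv in_setD [_ \in V]in_set => /andP[lv' lM].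
case/forestP: fF => _ fA fS.
have fA' x : x \in A -> x \notin v -> f x \in (A :\: V) :|: R.
  move=> xA xv; have xAV : x \in A :\: V by rewrite !inE xv.
  by have := fA x xAV; rewrite restrictE xAV.
have sub : (A :\: V) :|: R \subset A :|: R by rewrite setSU // subsetDl.
have step i : i.+1 < size v -> f (nth x0 v i) = nth x0 v i.+1.
  by have /(sortedP x0) H := sv => /H/eqP.
split; last first.
  apply/pendantP; split=> // y fy; apply/negPn/negP => yv.
  have [yA|yA] := boolP (y \in A); last first.
    by move: (sf y) x0A; rewrite yA => /eqP <-; rewrite vA.
  have := fA' y yA yv; rewrite !inE fy /= => yR.
  by have := disjointFr dAR (vA _ fy); rewrite yR.
apply/forestP; split=> [x xA|x xA|S SA clS].
- by apply/eqP; move: (sf x); rewrite xA.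
- have [xv|xv] := boolP (x \in v); last by apply: (subsetP sub); exact: fA'.
  have iv : index x v < size v by rewrite index_mem.
  rewrite -(nth_index x0 xv); case: (ltnP (index x v).+1 (size v)) => [lt|ge].
    by rewrite step // inE vA ?mem_nth.
  have -> : index x v = (size v).-1 by lia.
  by rewrite nth_last.
(* The forest outside [V] has no stable part, so [S] lies in the path. A nonempty [S] would then
   climb to the top of [v], whose parent is outside [V]. *)
- have SV0 : S :\: V = set0.
    apply: fS => [|x]; first exact: setSD.
    rewrite !inE => /andP[xv xS].
    rewrite restrictE !inE xv (subsetP SA) //= clS // andbT.
    have := fA' x (subsetP SA _ xS) xv; rewrite !inE.
    by case/orP=> [/andP[]//|xR]; have := disjointFl dAR xR; rewrite (subsetP SA) ?clS.
  have SV : S \subset V by rewrite -setD_eq0 SV0.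
  apply/eqP; rewrite -subset0; apply/subsetP=> x xS.
  have xv : x \in v by have := subsetP SV x xS; rewrite inE.
  have all_i i : index x v <= i -> i < size v -> nth x0 v i \in S.
    elim: i => [|i IH]; first by rewrite leqn0 => /eqP e _; rewrite -e nth_index.
    rewrite leq_eqVlt => /predU1P[<- _|]; first by rewrite nth_index.
    by rewrite ltnS => xi iv; rewrite -step // clS // IH // ltnW.
  have lS : last x0 v \in S.
    rewrite -nth_last all_i ?prednK // -ltnS prednK // index_mem //.
  by have := subsetP SV _ (clS _ lS); rewrite inE (negbTE lv').
Qed.

(** Deleting [v] leaves a forest in which [w] is still pendant, and [card_pendant] counts those. An
    inclusion into the glued maps is enough, since the variance only needs an upper bound. *)
Lemma card_pendant2 A R v w : [disjoint A & R] -> x0 \notin A ->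
  uniq v -> uniq w -> 0 < size v -> 0 < size w -> size v = size w ->
  {subset v <= A} -> {subset w <= A :\: [set z in v]} ->
  #|[set f in forest A R | pendant A f v && pendant A f w]| <=
  #|forest (A :\: [set z in v] :\: [set z in w]) R| *
  (#|A| + #|R| - size v - size w) ^ 2.
Proof.
move=> dAR x0A uv uw v0 w0 svw vA wA.
set V := [set z in v]; set W := [set z in w].
have VA : V \subset A by apply/subsetP=> z; rewrite inE => /vA.
have cV : #|V| = size v by rewrite cardsE; apply/card_uniqP.
have cW : #|W| = size w by rewrite cardsE; apply/card_uniqP.
have WA : W \subset (A :|: R) :\: V.
  by apply/subsetP=> z; rewrite inE => /wA; rewrite !inE => /andP[-> ->].
have cM : #|((A :|: R) :\: V) :\: W| = #|A| + #|R| - size v - size w.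
  rewrite cardsD (setIidPr _) // cW.
  rewrite cardsD (setIidPr _) ?cV; last exact: subset_trans VA (subsetUl _ _).
  by rewrite cardsU (_ : A :&: R = set0) ?cards0 ?subn0 //; apply/eqP; rewrite setI_eq0.
have cD : #|A :\: V| + #|R| - size w = #|A| + #|R| - size v - size w.
  have := subset_leq_card VA; rewrite cardsD (setIidPr VA) cV; lia.
rewrite expnS expn1 mulnA -{1}cD -card_pendant //; first last.
- by rewrite inE negb_and x0A orbT.
- exact: disjointWl (subsetDl _ _) dAR.
rewrite -cM -(card_tail_maps (((A :|: R) :\: V) :\: W) uv v0).
rewrite -(@card_glue (A :\: V) V); first last.
- exact: tail_maps_supp.
- by move=> f x; rewrite inE => /andP[fF _]; exact: forest_supp fF.
- exact: disjointDl.
apply/subset_leq_card/subsetP => f /setIdP[fF /andP[pv pw]]; rewrite in_set setDUK //.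
have /pendantP[_ sv prev] := pv; have /pendantP[_ sw prew] := pw.
have lvv := last_in v0.
apply/and3P; split.
- by apply/forallP=> x; apply/implyP=> xA; rewrite (forest_supp fF).
- rewrite inE forest_restrict //=; apply/pendantP; split=> //.
    by rewrite sorted_restrict.
  move=> y; rewrite restrictE; case: ifP => [_ /prew//|_] x0w.
  by move: (wA _ x0w); rewrite inE (negbTE x0A) andbF.
- apply: (restrict_tail fF pv v0); rewrite !in_setD.
  (* If the top of [v] hung from [w], pendancy of [w] would put it on [w], which is disjoint from
     [v]. *)
  have -> /= : f (last x0 v) \notin W.
    rewrite inE; apply/negP=> /prew /wA; by rewrite !inE lvv.
  rewrite [_ \in V]in_set (pendant_last fF pv v0) /=.
  by case/forestP: fF => _ fA _; apply: fA; apply: vA.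
Qed.

End Forests.

(** * Trees with a fixed root *)

Section RootedTrees.
Variables (T : finType) (x0 : T).
Implicit Types (f : {ffun T -> T}) (S : {set T}).
Notation A := (~: [set x0]).

Definition rooted_trees : {set {ffun T -> T}} := forest x0 A [set x0].
(** A pendant path is recorded by its leaf, so [#|ends f j|] is the number [N_j]. *)
Definition ends f j : {set T} := [set x | pendant A f (traject f x j)].

Lemma pendant_uniq B R f (v : seq T) : f \in forest x0 B R -> pendant B f v -> uniq v.
Proof.
move=> fF /pendantP[vA /(sorted_frelE x0) ev _]; have [d dA] := forest_depth fF.
move: vA; rewrite ev; move: (size v) (head x0 v) => j x vA.
apply/(uniqP x) => i k; rewrite !inE size_traject => ij kj.
rewrite !nth_traject // => e; case: (ltngtP i k) => // H.
  by have := traject_depth dA vA H (ltnW kj); rewrite e ltnn.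
by have := traject_depth dA vA H (ltnW ij); rewrite e ltnn.
Qed.

Lemma card_ends f j : 0 < j ->
  #|ends f j| = #|[set v : j.-tuple T | pendant A f v]|.
Proof.
move=> j0; pose tr x : j.-tuple T := Tuple (introT eqP (size_traject f x j)).
have trI : injective tr.
  by move=> x y /(congr1 (fun t : j.-tuple T => head x0 t)) /=; case: (j) j0.
rewrite -(card_imset _ trI); congr #|pred_of_set _|.
apply/setP=> v; rewrite inE; apply/imsetP/idP => [[x]|pv].
  by rewrite inE => px ->.
have /pendantP[_ /(sorted_frelE x0) ev _] := pv.
rewrite size_tuple in ev.
exists (head x0 v); first by rewrite inE -ev.
by apply/val_inj.
Qed.

(** * First and second moments of the number of pendant paths *)

Lemma card_rootC : #|A| = #|T|.-1.
Proof. by rewrite cardsC1. Qed.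

Lemma card_rooted_trees : #|rooted_trees| * #|T| = #|T| ^ #|T|.-1.
Proof.
have T0 : 0 < #|T| by apply/card_gt0P; exists x0.
have := @card_forest T x0 A [set x0]; rewrite card_rootC cards1 addn1 prednK // mul1n.
apply; by rewrite disjoints_subset.
Qed.

Lemma card_forest1 (B : {set T}) : B \subset A ->
  #|forest x0 B [set x0]| * #|B|.+1 = #|B|.+1 ^ #|B|.
Proof.
move=> BA; have := @card_forest T x0 B [set x0].
rewrite cards1 addn1 mul1n; apply; rewrite disjoints_subset.
by apply: subset_trans BA _.
Qed.

(** Double counting over injective sequences of non-root vertices. For each one, the [#|T| - j]
    places for the top cancel the denominator in the formula for the remaining forests. *)
Lemma first_moment j : 0 < j ->
  \sum_(f in rooted_trees) #|ends f j| = #|T|.-1 ^_ j * (#|T| - j) ^ (#|T|.-1 - j).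
Proof.
move=> j0; have T0 : 0 < #|T| by apply/card_gt0P; exists x0.
transitivity (\sum_(f in rooted_trees) \sum_(v : j.-tuple T | pendant A f v) 1).
  by apply: eq_bigr => f _; rewrite card_ends // -sum1_card; apply: eq_bigl => v; rewrite inE.
rewrite (exchange_big_dep (fun v : j.-tuple T => all (mem A) v && uniq v)) /=; last first.
  move=> f v fF pv; rewrite (pendant_uniq fF pv) andbT.
  by case/pendantP: pv => vA _ _; apply/allP.
rewrite -card_rootC -card_uniq_tuples -sum1_card big_distrl /=.
apply: eq_big => [v|v /andP[/allP vA uv]]; first by rewrite inE.
have v0 : 0 < size v by rewrite size_tuple.
have := @card_pendant T x0 A [set x0] v.
rewrite -sum1_card => H.
transitivity (\sum_(f in [set f in forest x0 A [set x0] | pendant A f v]) 1).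
  by apply: eq_bigl => f; rewrite [RHS]in_set.
have VA : [set z in v] \subset A by apply/subsetP=> z; rewrite inE => /vA.
have cV : #|[set z in v]| = j by rewrite cardsE (card_uniqP uv) size_tuple.
rewrite {}H //; [|by rewrite disjoints_subset|by rewrite !inE eqxx].
have jA := subset_leq_card VA; rewrite cV card_rootC in jA.
have cB : #|A :\: [set z in v]| = #|T|.-1 - j by rewrite cardsD (setIidPr VA) cV card_rootC.
have := @card_forest1 (A :\: [set z in v]) (subsetDl _ _).
rewrite cB size_tuple card_rootC cards1 addn1 prednK // mul1n.
by rewrite (_ : (#|T|.-1 - j).+1 = #|T| - j) //; lia.
Qed.

(** The left side counts ordered pairs of distinct pendant paths, which are disjoint by
    [pendant_disjoint]. Of the two factors [#|T| - j - j] coming from the tops, one cancels the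
    denominator of the forest formula. *)
Lemma second_moment j : 0 < j ->
  \sum_(f in rooted_trees) #|ends f j| * #|ends f j|.-1 <=
  #|T|.-1 ^_ j * ((#|T|.-1 - j) ^_ j * (#|T| - j - j) ^ (#|T| - j - j)).
Proof.
move=> j0; have T0 : 0 < #|T| by apply/card_gt0P; exists x0.
pose P1 (v : j.-tuple T) := all (mem A) v && uniq v.
pose P2 (v w : j.-tuple T) := all (mem (A :\: [set z in v])) w && uniq w.
apply: (@leq_trans (\sum_(f in rooted_trees) \sum_(v : j.-tuple T | pendant A f v)
   \sum_(w : j.-tuple T | pendant A f w && (w != v)) 1)).
  apply/leq_sum => f _; rewrite card_ends // -[X in X * _]sum1_card big_distrl /=.
  apply: eq_leq; apply: eq_big => [v|v]; first by rewrite inE.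
  move=> vP; rewrite mul1n (cardsD1 v) vP /= -sum1_card.
  by apply: eq_bigl => w; rewrite !inE andbC.
rewrite (exchange_big_dep P1) /=; last first.
  move=> f v fF pv; rewrite /P1 (pendant_uniq fF pv) andbT.
  by case/pendantP: pv => vA _ _; apply/allP.
rewrite -{1}card_rootC -card_uniq_tuples -sum1_card big_distrl /=.
apply: (@leq_trans (\sum_(v | P1 v) 1 *
  ((#|T|.-1 - j) ^_ j * (#|T| - j - j) ^ (#|T| - j - j)))); last first.
  by apply: eq_leq; apply: eq_bigl => v; rewrite inE.
apply: leq_sum => v /andP[/allP vA uv]; rewrite mul1n.
have v0 : 0 < size v by rewrite size_tuple.
have VA : [set z in v] \subset A by apply/subsetP=> z; rewrite inE => /vA.
have cV : #|[set z in v]| = j by rewrite cardsE (card_uniqP uv) size_tuple.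
have jA := subset_leq_card VA; rewrite cV card_rootC in jA.
have cB : #|A :\: [set z in v]| = #|T|.-1 - j by rewrite cardsD (setIidPr VA) cV card_rootC.
rewrite (exchange_big_dep (P2 v)) /=; last first.
  move=> f w /andP[fF pv] /andP[pw nvw]; rewrite /P2 (pendant_uniq fF pw) andbT.
  have /pendantP[wA _ _] := pw.
  have dis := pendant_disjoint fF pv pw _ _.
  apply/allP=> z zw; rewrite /= in_setD wA // andbT inE.
  by rewrite (disjointFl (dis _ _) zw) // ?size_tuple // eq_sym.
rewrite -{1}cB -card_uniq_tuples -sum1_card big_distrl /=.
apply: (@leq_trans (\sum_(w | P2 v w) 1 * (#|T| - j - j) ^ (#|T| - j - j))); last first.
  by apply: eq_leq; apply: eq_bigl => w; rewrite inE.
apply: leq_sum => w /andP[/allP wA uw]; rewrite mul1n.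
have w0 : 0 < size w by rewrite size_tuple.
have WA : [set z in w] \subset A :\: [set z in v].
  by apply/subsetP=> z; rewrite inE => /wA.
have cW : #|[set z in w]| = j by rewrite cardsE (card_uniqP uw) size_tuple.
have jB := subset_leq_card WA; rewrite cW cB in jB.
have cC : #|A :\: [set z in v] :\: [set z in w]| = #|T|.-1 - j - j.
  by rewrite cardsD (setIidPr WA) cW cB.
have := @card_pendant2 T x0 A [set x0] v w.
rewrite -sum1_card => H.
apply: (@leq_trans (\sum_(f in [set f in forest x0 A [set x0] |
                               pendant A f v && pendant A f w]) 1)).
  rewrite big_mkcond [X in _ <= X]big_mkcond /=; apply: leq_sum => f _.
  case: ifP => // /andP[/andP[fF pv] /andP[pw _]].
  by rewrite in_set fF pv pw.
apply: leq_trans (H _ _ uv uw _ _ _ vA _) _ => //.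
- by rewrite disjoints_subset.
- by rewrite !inE eqxx.
- by rewrite !size_tuple.
rewrite !size_tuple card_rootC cards1 addn1 prednK // expnS expn1 mulnA.
have := @card_forest1 (A :\: [set z in v] :\: [set z in w]).
rewrite cC (_ : (#|T|.-1 - j - j).+1 = #|T| - j - j); last by lia.
move=> ->; last by apply: subset_trans (subsetDl _ _) (subsetDl _ _).
rewrite -expnSr (_ : (#|T|.-1 - j - j).+1 = #|T| - j - j) //; lia.
Qed.

(** * Vertex sets of the sub-trees containing the root *)

Definition closed_sets f : {set {set T}} :=
  [set S : {set T} | (x0 \in S) && (f @: S \subset S)].

(** Only the dropped top could hang from the shorter path without lying on it, and the strict
    decrease of depth excludes that. *)
Lemma ends_anti f j : f \in rooted_trees -> ends f j.+1 \subset ends f j.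
Proof.
move=> fF; have [d dA] := forest_depth fF.
apply/subsetP=> x; rewrite !inE => /pendantP[xA sx px].
have sub i : i \in traject f x j -> i \in traject f x j.+1.
  by move=> /trajectP[k kj ->]; apply/trajectP; exists k; rewrite // ltnW.
apply/pendantP; split.
- by move=> y /sub/xA.
- by case: (j) => //= k; apply: fpath_traject.
- move=> y fy; have /trajectP[k] := px y (sub _ fy).
  rewrite ltnS leq_eqVlt => /predU1P[->|kj] e; last by apply/trajectP; exists k.
  have /trajectP[i ij fi] := fy.
  have := traject_depth dA xA (leqW ij : i < j.+1) (leqnn _).
  by rewrite iterS -e fi ltnn.
Qed.

(* The length, capped at 3, of the longest pendant path starting at [x]. *)
Definition chain f x : nat := (x \in ends f 1) + (x \in ends f 2) + (x \in ends f 3).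

Lemma chain_ends f x : f \in rooted_trees -> x \in ends f (chain f x).
Proof.
move=> fF; have s2 := subsetP (ends_anti 1 fF) x; have s3 := subsetP (ends_anti 2 fF) x.
rewrite /chain.
case: (boolP (x \in ends f 3)) => h3; first by rewrite s2 // s3.
case: (boolP (x \in ends f 2)) => h2; first by rewrite s2.
case: (boolP (x \in ends f 1)) => h1 //.
by rewrite inE; apply/pendantP.
Qed.

Lemma chain_le3 f x : chain f x < 4.
Proof. by rewrite /chain; do 3!case: (_ \in _). Qed.

(* From the pendant path of each leaf independently one may cut off between [0]
   and [chain f x] of its lowest vertices. *)
Lemma closed_sets_lower f : f \in rooted_trees ->
  \prod_(x : T) (chain f x).+1 <= #|closed_sets f|.
Proof.
move=> fF.
pose F x := [pred k : 'I_4 | k <= chain f x].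
have cF x : #|F x| = (chain f x).+1.
  rewrite -sum1_card (eq_bigl (fun k : 'I_4 => k < (chain f x).+1)) //.
  rewrite -(big_ord_widen 4 (fun=> 1)) ?chain_le3 // sum_nat_const card_ord muln1 //.
have <- : #|family F| = \prod_(x : T) (chain f x).+1.
  by rewrite card_family foldrE big_image /=; apply: eq_bigr => x _; rewrite cF.
pose rm (r : {ffun T -> 'I_4}) : {set T} :=
  [set y | [exists x, exists i : 'I_4, (i < r x) && (y == iter i f x)]].
have rmP (r : {ffun T -> 'I_4}) y :
    reflect (exists x, exists2 i, i < r x & y = iter i f x) (y \in rm r).
  rewrite inE; apply: (iffP existsP) => [[x /existsP[i /andP[ix /eqP ->]]]|[x [i ir ->]]].
    by exists x; exists i.
  have i4 : i < 4 by apply: ltn_trans ir (ltn_ord _).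
  by exists x; apply/existsP; exists (Ordinal i4); rewrite /= ir eqxx.
have pe x : pendant A f (traject f x (chain f x)) by have := chain_ends x fF; rewrite inE.
(* By [pendant_index] a vertex on these paths determines its leaf and its height, so [r] can be read
   off from [rm r]. *)
have key (r : {ffun T -> 'I_4}) x i : r \in family F -> i < chain f x ->
    (iter i f x \in rm r) = (i < r x).
  move=> /familyP rF ic; apply/rmP/idP => [[y [k kr e]]|ir]; last by exists x; exists i.
  have ky : k < chain f y by apply: leq_trans kr (rF y).
  by have [-> ->] := pendant_index fF (pe x) (pe y) ic ky e.
have inj : {in family F &, injective (fun r => ~: rm r)}.
  move=> r s rF sF /setC_inj e; apply/ffunP=> x; apply/val_inj.
  have /familyP/(_ x) rc := rF; have /familyP/(_ x) sc := sF.
  rewrite !inE in rc sc; case: (ltngtP (r x) (s x)) => // lt.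
    have := key s x (r x) sF (leq_trans lt sc).
    by rewrite -e key ?(leq_trans lt sc) // ltnn lt.
  have := key r x (s x) rF (leq_trans lt rc).
  by rewrite e key ?(leq_trans lt rc) // ltnn lt.
rewrite -(card_in_imset inj); apply/subset_leq_card/subsetP=> _ /imsetP[r /familyP rF ->].
have rmA y : y \in rm r -> exists x, exists2 i, i < r x & [/\ i < chain f x & y = iter i f x].
  move=> /rmP[x [i ir ->]]; exists x; exists i => //; split=> //.
  exact: leq_trans ir (rF x).
rewrite inE; apply/andP; split.
  rewrite inE; apply/negP=> /rmA[x [i ir [ic e]]].
  have /pendantP[/(_ x0)] := pe x; rewrite !inE eqxx => H _ _.
  by apply/negP/H => //; apply/trajectP; exists i.
(* A vertex whose parent is cut lies one place lower on the same path, hence is cut as well. *)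
apply/subsetP=> _ /imsetP[y ynr ->]; move: ynr; rewrite !in_setC; apply: contra.
move=> /rmA[x [i ir [ic e]]].
have /pendantP[xA _ px] := pe x.
have /trajectP[k kc ye] : y \in traject f x (chain f x).
  by apply: px; rewrite e; apply/trajectP; exists i.
have [d dA] := forest_depth fF.
have ki : i = k.+1.
  have e' : iter i f x = iter k.+1 f x by rewrite -e ye.
  case: (ltngtP i k.+1) => // H.
    by have := traject_depth dA xA H kc; rewrite e' ltnn.
  by have := traject_depth dA xA H (ltnW ic); rewrite e' ltnn.
by apply/rmP; exists x; exists k => //; apply: ltn_trans ir; rewrite ki.
Qed.

(** This is the bound [2^N_1 (3/2)^N_2 (4/3)^N_3] cleared of denominators. A vertex with
    [chain f x = c] contributes the telescoping product of [(i + 1) / i] for [1 <= i <= c]. *)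
Lemma card_closed_sets f : f \in rooted_trees ->
  2 ^ #|ends f 1| * 3 ^ #|ends f 2| * 4 ^ #|ends f 3| <=
  #|closed_sets f| * 2 ^ #|ends f 2| * 3 ^ #|ends f 3|.
Proof.
move=> fF; apply: leq_trans (_ : \prod_(x : T) (chain f x).+1 *
  2 ^ #|ends f 2| * 3 ^ #|ends f 3| <= _); last first.
  by rewrite -!mulnA leq_mul2r closed_sets_lower ?orbT.
have ce j c : c ^ #|ends f j| = \prod_(x : T) c ^ (x \in ends f j).
  rewrite -expn_sum; congr (_ ^ _).
  by rewrite -sum1_card big_mkcond /=; apply: eq_bigr => x _; case: (_ \in _).
rewrite !ce -!big_split /=; apply: eq_leq; apply: eq_bigr => x _.
have s2 := subsetP (ends_anti 1 fF) x; have s3 := subsetP (ends_anti 2 fF) x.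
rewrite /chain.
case: (boolP (x \in ends f 3)) => h3; first by rewrite s2 // s3.
case: (boolP (x \in ends f 2)) => h2; first by rewrite s2.
by case: (boolP (x \in ends f 1)) => h1 //.
Qed.

(** * Correspondence between parent maps and labelled trees *)

Definition parent_edges f S : {set {set T}} := [set [set x; f x] | x in S :\ x0].

Lemma set2_eq (x y u v : T) : [set x; y] = [set u; v] ->
  (x = u /\ y = v) \/ (x = v /\ y = u).
Proof.
move=> /setP e; move: (e x) (e y) (e u) (e v); rewrite !inE !eqxx /= ?orbT.
move=> /esym/orP[]/eqP ex /esym/orP[]/eqP ey; subst; rewrite ?eqxx ?orbT; auto.
  by move=> _ /orP[]/eqP->; auto.
by move=> /orP[]/eqP->; auto.
Qed.

Lemma adj_parent f S x y : adj (parent_edges f S) x y ->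
  [/\ x \in S, x != x0 & y = f x] \/ [/\ y \in S, y != x0 & x = f y].
Proof.
case/imsetP=> u; rewrite !inE => /andP[u0 uS] /set2_eq[] [-> ->]; by [left | right].
Qed.

Lemma adj_parent_edge f S x : x \in S -> x != x0 -> adj (parent_edges f S) x (f x).
Proof. by move=> xS x1; apply/imsetP; exists x; rewrite // !inE x1. Qed.

Lemma rooted_depth f : f \in rooted_trees ->
  exists d : T -> nat, forall x, x != x0 -> d (f x) < d x.
Proof.
by move=> /forest_depth[d dA]; exists d => x x1; apply: dA; rewrite !inE.
Qed.

Lemma adj_sym (E : {set {set T}}) : symmetric (adj E).
Proof. by move=> x y; rewrite /adj setUC. Qed.

(** Both neighbours of a deepest vertex of the cycle would have to be its parent, yet they are
    distinct. *)
Lemma acyclic_parent f S : f \in rooted_trees -> acyclic (parent_edges f S).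
Proof.
move=> /rooted_depth[d dA] c c2 /andP[cyc u].
have [z zc] : exists z, z \in c by case: (c) c2 => // z s _; exists z; rewrite mem_head.
case: (arg_maxnP d zc) => x xc xmax.
have [i s rs] := rot_to xc.
move: cyc u c2; rewrite -(rot_cycle i) -(rot_uniq i) -(size_rot i) rs.
have {}xmax y : y \in x :: s -> d y <= d x by rewrite -rs mem_rot => /xmax.
case: s rs xmax => [|y [|z' s]] // rs xmax.
rewrite /= rcons_path => /and4P[xy _ _ lx] /and3P[_ yz _] _.
have up w : w \in [:: x, y, z' & s] -> adj (parent_edges f S) x w -> w = f x.
  move=> wc /adj_parent[[]//|[_ w1 e]].
  by have := dA w w1; rewrite -e ltnNge xmax.
have yf : y = f x by apply: up => //; rewrite !inE eqxx orbT.
have lf : last z' s = f x.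
  by apply: up; [rewrite 2!in_cons mem_last !orbT | rewrite adj_sym].
by move: yz; rewrite yf -lf mem_last.
Qed.

Lemma parent_tree f S : f \in rooted_trees -> S \in closed_sets f ->
  is_tree S (parent_edges f S).
Proof.
move=> fF; rewrite inE => /andP[S0 /subsetP clS].
have [d dA] := rooted_depth fF.
split; last exact: acyclic_parent.
- apply/forall_inP=> _ /imsetP[x + ->]; rewrite !inE => /andP[x1 xS].
  apply/andP; split.
    by apply/subsetP=> y; rewrite !inE => /orP[]/eqP-> //; apply: clS; apply: imset_f.
  rewrite cards2; apply/eqP; congr (_.+1); case: eqVneq => // e.
  by have := dA x x1; rewrite -e ltnn.
- apply/andP; split; first by apply/card_gt0P; exists x0.
  have c0 x : x \in S -> connect (adj (parent_edges f S)) x x0.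
    have [m] := ubnP (d x); elim: m x => // m IH x; rewrite ltnS => dm xS.
    have [->|x1] := eqVneq x x0; first exact: connect0.
    apply: connect_trans (connect1 (adj_parent_edge f xS x1)) (IH _ _ _).
      exact: leq_trans (dA x x1) dm.
    by apply: clS; apply: imset_f.
  apply/forall_inP=> x xS; apply/forall_inP=> y yS.
  apply: connect_trans (c0 x xS) _.
  by rewrite (sym_connect_sym (@adj_sym _)) c0.
Qed.

(** Induction on depth. If the edge from [x] to [f x] is not the parent edge of [x] under [g], then
    [x = g (f x)], which is [f (f x)] by induction, against the depth. *)
Lemma parent_edges_inj : {in rooted_trees &, injective (parent_edges^~ setT)}.
Proof.
move=> f g fF gF e; have [d dA] := rooted_depth fF; have [d' dA'] := rooted_depth gF.
have root h : h \in rooted_trees -> h x0 = x0.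
  by move=> /forestP[H _ _]; apply: H; rewrite !inE eqxx.
apply/ffunP=> x; have [m] := ubnP (d x); elim: m x => // m IH x; rewrite ltnS => dm.
have [->|x1] := eqVneq x x0; first by rewrite !root.
have := adj_parent_edge f (in_setT x) x1; rewrite e => /adj_parent[[]//|[_ f1 xe]].
have fx : f (f x) = g (f x) by apply: IH; apply: leq_trans (dA x x1) dm.
by have := ltn_trans (dA _ f1) (dA x x1); rewrite fx -xe ltnn.
Qed.

Lemma setT_closed f : [set: T] \in closed_sets f.
Proof. by rewrite inE in_setT subsetT. Qed.

(** The parent of [x] is a neighbour closer to [x0]. The parent edges already connect all vertices,
    so a further edge of [E] would close a cycle. *)
Lemma tree_parent (E : {set {set T}}) : is_tree [set: T] E ->
  exists2 f, f \in rooted_trees & parent_edges f setT = E.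
Proof.
case=> /forall_inP gE /andP[_ /forall_inP cE] acE.
have ex x : exists k, [exists p : k.-tuple T, path (adj E) x p && (last x p == x0)].
  have /forall_inP/(_ x0 (in_setT _))/connectP[p px lx] := cE x (in_setT x).
  by exists (size p); apply/existsP; exists (in_tuple p); rewrite px -lx eqxx.
pose d x := ex_minn (ex x).
have step x : x != x0 -> exists y, adj E x y && (d y < d x).
  move=> x1; rewrite {2}/d; case: ex_minnP => k /existsP[p /andP[px lx]] _.
  have := size_tuple p; case: (tval p) px lx => [|y s] /=.
    by move=> _ /eqP e; rewrite e eqxx in x1.
  move=> /andP[xy ys] ls <-; exists y; rewrite xy ltnS /d; case: ex_minnP => l _; apply.
  by apply/existsP; exists (in_tuple s); rewrite ys.
pose f : {ffun T -> T} := [ffun x => if x == x0 then x0 else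
   odflt x0 [pick y | adj E x y && (d y < d x)]].
have f0 : f x0 = x0 by rewrite ffunE eqxx.
have f1 x : x != x0 -> adj E x (f x) /\ d (f x) < d x.
  move=> x1; rewrite ffunE (negbTE x1); case: pickP => [y /andP[]//|H].
  by have [y] := step x x1; rewrite H.
have fF : f \in rooted_trees.
  apply/forestP; split=> [x|x _|S SA clS].
  - by rewrite !inE negbK => /eqP->.
  - by rewrite setUC setUCr inE.
  - apply/eqP; apply/negPn/negP=> /set0Pn[z zS]; case: (arg_minnP d zS) => x xS xmin.
    have x1 : x != x0 by have := subsetP SA x xS; rewrite !inE.
    by have [_] := f1 x x1; have := xmin _ (clS x xS); rewrite /= leqNgt => /negbTE->.
exists f => //.
have sub : parent_edges f setT \subset E.
  by apply/subsetP=> _ /imsetP[x + ->]; rewrite !inE andbT => /f1[].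
apply/eqP; rewrite eqEsubset sub /=; apply/subsetP=> e eE.
have /andP[_ /cards2P[x [y [xy ee]]]] := gE e eE; rewrite ee in eE *.
apply/negPn/negP=> ne.
have [_ /andP[_ /forall_inP cf] _] := parent_tree fF (setT_closed f).
have /forall_inP/(_ y (in_setT _))/connectP[p px ly] := cf x (in_setT x).
case/shortenP: px ly => q qx uq _ ly.
apply: (acE (x :: q)).
  (* A path of length one would make the edge a parent edge, so the cycle has more than two
     vertices. *)
  case: q qx uq ly => [|z [|]] //=; first by move=> _ _ e'; rewrite e' eqxx in xy.
  by rewrite andbT => xz _ yz; rewrite -yz in xz; case/negP: ne.
apply/andP; split=> //; rewrite /= rcons_path -ly adj_sym.
rewrite [adj E _ _]eE andbT.
by apply: sub_path qx => u v; apply: (subsetP sub).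
Qed.

Lemma card_subtrees f : f \in rooted_trees ->
  #|closed_sets f| <= #|subtrees (parent_edges f setT)|.
Proof.
move=> fF; pose F S := (S, parent_edges f S).
have inj : injective F by move=> S S' [].
rewrite -(card_imset _ inj); apply/subset_leq_card/subsetP=> _ /imsetP[S SC ->].
rewrite inE /=; apply/andP; split; last by apply/asboolP; exact: parent_tree.
by apply: imsetS; apply: setSD; apply: subsetT.
Qed.

End RootedTrees.

(** * Numerical estimates *)

From mathcomp Require Import all_order all_algebra ring lra.
Import Order.TTheory GRing.Theory Num.Theory.

Section NatBounds.
Local Open Scope nat_scope.

(** Factor by factor: [(a - j - i) * a.+1 <= (a - i) * (a.+1 - j)]. *)
Lemma ffact_shift_le a j k : (a - j) ^_ k * a.+1 ^ k <= a ^_ k * (a.+1 - j) ^ k.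
Proof.
elim: k => // k IH; rewrite !ffactnSr !expnSr.
rewrite mulnACA [X in _ <= X]mulnACA leq_mul //; nia.
Qed.

Lemma ffact_ge a j k : k <= j -> (a.+1 - j) ^ k <= a ^_ k.
Proof.
elim: k => // k IH kj; rewrite ffactnSr expnSr leq_mul ?IH ?(ltnW kj) //; lia.
Qed.

(** With [t] trees and [N] pendant paths, this bounds the mean of [N (N - 1)] by [n / (n - j)] times
    the squared mean of [N]. The powers are compared through [n * (n - 2 j) <= (n - j) ^ 2]. *)
Lemma moment_ratio a j t (n := a.+1) : 0 < j <= 3 -> j.*2 < n -> t * n = n ^ a ->
  a ^_ j * ((a - j) ^_ j * (n - j - j) ^ (n - j - j)) * t * (n - j) <=
  (a ^_ j * (n - j) ^ (a - j)) ^ 2 * n.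
Proof.
move=> /andP[j0 j3] jn tn.
set F := a ^_ j; set G := (a - j) ^_ j; set m := n - j; set k := n - j - j.
have n0 : 0 < n by [].
have m0 : 0 < m by rewrite /m; lia.
have h1 : G * n ^ j <= F * m ^ j by exact: ffact_shift_le.
have h2 : k ^ k * n ^ k <= m ^ (k + k).
  rewrite -expnMn addnn -mul2n expnM leq_exp2r; last by rewrite /k; lia.
  rewrite /k /m; nia.
have h3 : t * n = n ^ k * n ^ (j + j).-1.
  by rewrite tn -expnD; congr (_ ^ _); rewrite /k /n; lia.
have e : (m ^ (a - j)) ^ 2 * m ^ 2 = m ^ (k + k) * m ^ j * m ^ j.
  by rewrite -expnM -!expnD; congr (_ ^ _); rewrite /k /n; lia.
have key : F * (G * k ^ k) * t * (n * n ^ j * m ^ j) <=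
           (F * m ^ (a - j)) ^ 2 * m ^ 2 * n ^ (j + j).-1.
  rewrite expnMn -(mulnA (F ^ 2)) e.
  have -> : F * (G * k ^ k) * t * (n * n ^ j * m ^ j) =
      F * (G * n ^ j) * (k ^ k * (t * n)) * m ^ j by ring.
  rewrite h3 [k ^ k * _]mulnA.
  have -> : F ^ 2 * (m ^ (k + k) * m ^ j * m ^ j) * n ^ (j + j).-1 =
      F * (F * m ^ j) * (m ^ (k + k) * n ^ (j + j).-1) * m ^ j by ring.
  by apply: leq_mul => //; apply: leq_mul; apply: leq_mul.
have mn : m <= n by rewrite /m; lia.
move: key; set X := F * _ * t; set Y := (F * _) ^ 2.
(* After cancellation [key] reads [X * m ^ (j - 2) <= Y * n ^ (j - 2)], with a negative exponent for
   [j = 1]. The goal is the form for [j = 3]; the other two imply it because [m <= n]. *)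
have j123 : [|| j == 1, j == 2 | j == 3] by lia.
case/or3P: j123 => /eqP -> /=.
- rewrite !expn1 => H.
  have {}H : X * n <= Y * m.
    have p : 0 < n * m by rewrite muln_gt0 n0.
    by rewrite -(leq_pmul2r p); apply: leq_trans (leq_trans H _); apply: eq_leq; ring.
  apply: (@leq_trans (X * n)); first by rewrite leq_mul2l mn orbT.
  by apply: leq_trans H _; rewrite leq_mul2l mn orbT.
- move=> H; have {}H : X <= Y.
    have p : 0 < n ^ 3 * m ^ 2 by rewrite muln_gt0 !expn_gt0 n0 m0.
    by rewrite -(leq_pmul2r p); apply: leq_trans (leq_trans H _); apply: eq_leq; ring.
  by rewrite leq_mul.
- move=> H.
  have p : 0 < n ^ 4 * m ^ 2 by rewrite muln_gt0 !expn_gt0 n0 m0.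
  by rewrite -(leq_pmul2r p); apply: leq_trans (leq_trans H _); apply: eq_leq; ring.
Qed.

End NatBounds.

Local Open Scope ring_scope.

(** * Explicit estimates near [1 / e], and Chebyshev's inequality *)

Section RealBounds.
Variable R : realFieldType.

(* [(N - s) / (N + s)] is the Pade approximant of [exp (-2 s / N)]; unlike
   Bernoulli's inequality it loses only a third-order term, so that eight blocks
   suffice in [one_sub_inv_pow_ge]. *)
Lemma pade_pow_ge (N : R) (s : nat) : 1 <= N -> s%:R <= N ->
  (N - s%:R) / (N + s%:R) <= ((N - 1) / (N + 1)) ^+ s.
Proof.
move=> N1; elim: s => [|s IH] sN; first by rewrite subr0 addr0 divff ?expr0 //; lra.
have s0 : 0 <= s%:R :> R by [].
rewrite -natr1 in sN *; set x : R := s%:R in IH sN s0 *.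
rewrite exprSr; apply: le_trans (_ : (N - x) / (N + x) * ((N - 1) / (N + 1)) <= _).
  rewrite mulf_div ler_pdivrMr; last by lra.
  rewrite mulrAC ler_pdivlMr; last by rewrite mulr_gt0 //; lra.
  rewrite -subr_ge0.
  have -> : (N - x) * (N - 1) * (N + (x + 1)) - (N - (x + 1)) * ((N + x) * (N + 1))
     = 2 * (x * x + x) by ring.
  by nra.
apply: ler_wpM2r; last by apply: IH; lra.
by rewrite divr_ge0 //; lra.
Qed.

Lemma le_sqr_trans (y b c : R) : 0 <= b -> b <= y -> c <= b * b -> c <= y ^+ 2.
Proof. by move=> b0 yb cb; rewrite expr2; apply: le_trans cb _; apply: ler_pM. Qed.

(* [917 / 2500 = 0.3668] is slightly below [1 / e]. *)
Lemma one_sub_inv_pow_ge (m : nat) : 200%:R * 100%:R <= m%:R :> R ->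
  917 / 2500 <= (1 - m%:R^-1) ^+ m.+1 :> R.
Proof.
move=> hm; set x : R := 1 - _.
have m0 : 0 < m%:R :> R by lra.
(* Chosen so that [1 - 1 / m] takes the form [(N - 1) / (N + 1)] of [pade_pow_ge]. *)
pose N : R := 2 * m%:R - 1.
have xE : x = (N - 1) / (N + 1) by rewrite /x /N; field; rewrite ?lt0r_neq0 //; lra.
have x01 : 0 <= x <= 1.
  by rewrite /x subr_ge0 invf_le1 // gerBl invr_ge0 ltW //; lra.
pose s := (m %/ 8).+1.
have s1 : (m.+1 <= s * 8)%N by rewrite /s; lia.
have s2 : 8 * s%:R <= m%:R + 8 :> R.
  by rewrite -natrM -natrD ler_nat /s; lia.
move: s s1 s2 => s s1 s2.
apply: le_trans (_ : x ^+ (s * 8) <= _); last first.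
  by apply: ler_wiXn2l => //; case/andP: x01.
rewrite exprM.
(* As [s] is about [m / 8] and [N] about [2 m], the ratio is close to [15 / 17]; [1499 / 1699] lies
   just below. *)
have h0 : 1499 / 1699 <= x ^+ s.
  rewrite xE; apply: le_trans (pade_pow_ge _ _); rewrite /N; try lra.
  have sR : 0 <= s%:R :> R by [].
  rewrite ler_pdivlMr; last by lra.
  rewrite mulrAC ler_pdivrMr; last by lra.
  lra.
have -> : x ^+ s ^+ 8 = ((x ^+ s ^+ 2) ^+ 2) ^+ 2 by rewrite -!exprM.
(* Three squarings, each rounded down, lead from [1499 / 1699] to [917 / 2500]. *)
apply: (@le_sqr_trans _ (3029 / 5000)); [lra| |lra].
apply: (@le_sqr_trans _ (973 / 1250)); [lra| |lra].
by apply: (@le_sqr_trans _ (1499 / 1699)); [lra| |lra].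
Qed.

(** The right side bounds from below the mean of [N_j] divided by [n]. The ratio [(n - j) / n] is
    the product of [1 - 1 / (n - i)] over [i < j], and each factor is at least [1 - 1 / (n - 2)]. *)
Lemma first_moment_ratio (n j : nat) : (0 < j <= 3)%N ->
  200%:R * 100%:R + 2 <= n%:R :> R ->
  (917 / 2500) ^+ j <= ((n - j)%:R / n%:R) ^+ n.-1 :> R.
Proof.
move=> /andP[j0 j3] hn.
have n3 : (3 < n)%N by rewrite -(ltr_nat R); lra.
pose m := (n - 2)%N.
have mE : m%:R = n%:R - 2 :> R by rewrite natrB //; lia.
have m0 : 0 < m%:R :> R by rewrite mE; lra.
have hm : 200%:R * 100%:R <= m%:R :> R by rewrite mE; lra.
have mi : m%:R^-1 <= 1 :> R by rewrite invf_le1 //; lra.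
have -> : n.-1 = m.+1 by rewrite /m; lia.
have base : (1 - m%:R^-1) ^+ j <= (n - j)%:R / n%:R :> R.
  pose q i : R := (n - i)%:R / n%:R.
  have {j0} : (j <= 3)%N by [].
  rewrite -/(q j); elim: j {j3} => [|i IH] i3.
    by rewrite /q subn0 expr0 divff // lt0r_neq0 //; lra.
  have -> : q i.+1 = q i * (1 - (n - i)%:R^-1).
    rewrite /q -addn1 subnDA (natrB _ (_ : 1 <= n - i)%N); last by lia.
    field; rewrite !pnatr_eq0; lia.
  rewrite exprSr; apply: ler_pM.
  - by rewrite exprn_ge0 // subr_ge0.
  - by rewrite subr_ge0.
  - by apply: IH; lia.
  - by rewrite lerD2l lerN2 lef_pV2 ?ler_nat ?posrE ?ltr0n //; rewrite /m; lia.
have b0 : 0 <= 1 - m%:R^-1 :> R by rewrite subr_ge0.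
apply: le_trans (_ : ((1 - m%:R^-1) ^+ j) ^+ m.+1 <= _).
  rewrite exprAC; apply: lerXn2r; rewrite ?nnegrE ?exprn_ge0 //; first by lra.
  exact: one_sub_inv_pow_ge.
by apply: lerXn2r; rewrite ?nnegrE ?exprn_ge0 // divr_ge0.
Qed.

(** Chebyshev's inequality with means written as sums over [X]; the hypotheses on [M2] keep the
    variance below [13 n]. *)
Lemma chebyshev_count (I : finType) (X : {set I}) (N : I -> nat) (n M2 : nat)
    (al dl : R) : (3 < n)%N -> 0 < dl ->
  (forall i, i \in X -> (N i <= n)%N) ->
  (\sum_(i in X) N i * (N i).-1 <= M2)%N ->
  (M2 * #|X| * (n - 3) <= (\sum_(i in X) N i) ^ 2 * n)%N ->
  (al + dl) * (n%:R * #|X|%:R) <= (\sum_(i in X) N i)%:R ->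
  #|[set i in X | (N i)%:R < al * n%:R]|%:R * (dl ^+ 2 * n%:R) <= 13 * #|X|%:R.
Proof.
move=> n3 dl0 Nn hM2 hvar hmu.
set B := [set i in X | _].
have [t0|] := posnP #|X|.
  have : (#|B| <= #|X|)%N.
    by apply/subset_leq_card/subsetP=> i; rewrite inE => /andP[].
  by rewrite t0 leqn0 => /eqP->; rewrite mul0r mulr0.
rewrite -(ltr0n R); set t : R := #|X|%:R => t0.
set M1 := (\sum_(i in X) N i)%N in hvar hmu.
set M : R := M1%:R in hmu.
have nr : 3 < n%:R :> R by rewrite ltr_nat.
have nr4 : 4 <= n%:R :> R by rewrite ler_nat.
have hvar' : M2%:R * t * (n%:R - 3) <= M ^+ 2 * n%:R.
  by rewrite -(natrB _ (ltnW n3)) -!natrM -natrX -natrM ler_nat.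
have Mle : M <= n%:R * t.
  rewrite /M /t -natrM ler_nat mulnC -sum_nat_const; exact: leq_sum.
have M0 : 0 <= M by rewrite /M.
have ME : \sum_(i in X) (N i)%:R = M by rewrite /M natr_sum.
have NE : \sum_(i in X) (N i)%:R ^+ 2 <= M2%:R + M.
  rewrite -(ler_nat R) natr_sum in hM2.
  apply: le_trans (lerD hM2 (lexx M)); rewrite -ME -big_split /=.
  apply: ler_sum => i _; case: (N i) => [|k]; first by rewrite mul0n expr2 mul0r addr0.
  by rewrite -natrX -natrD ler_nat /=; lia.
pose mu := M / t.
have sumE : \sum_(i in X) ((N i)%:R - mu) ^+ 2 =
   \sum_(i in X) (N i)%:R ^+ 2 - M * mu.
  under eq_bigr do rewrite sqrrB.
  rewrite big_split sumrB /= sumr_const sumrMnl -mulr_suml ME.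
  rewrite -[_ *+ #|X|]mulr_natr -/t /mu; field; exact: lt0r_neq0.
have low : #|B|%:R * (dl * n%:R) ^+ 2 <= \sum_(i in X) ((N i)%:R - mu) ^+ 2.
  rewrite mulr_natl -sumr_const [X in _ <= X](bigID (mem B)) /=.
  have -> : \sum_(i in B) (dl * n%:R) ^+ 2 = \sum_(i in X | i \in B) (dl * n%:R) ^+ 2.
    by apply: eq_bigl => i; rewrite inE andbA andbb.
  rewrite -[X in X <= _]addr0; apply: lerD; last by apply: sumr_ge0 => i _; exact: sqr_ge0.
  apply: ler_sum => i /andP[_]; rewrite inE => /andP[_ Ni].
  have hmu' : (al + dl) * n%:R <= mu by rewrite /mu ler_pdivlMr // -mulrA.
  rewrite -[X in _ <= X]sqrrN opprB; apply: lerXn2r; rewrite ?nnegrE; last by lra.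
    by rewrite mulr_ge0 // ltW.
  have : 0 <= dl * n%:R by rewrite mulr_ge0 // ltW.
  lra.
have up : \sum_(i in X) ((N i)%:R - mu) ^+ 2 <= 13 * (n%:R * t).
  rewrite sumE; apply: le_trans (lerB NE (lexx _)) _.
  have muM : M * mu * t = M ^+ 2 by rewrite /mu; field; exact: lt0r_neq0.
  have mun : mu <= n%:R by rewrite /mu ler_pdivrMr.
  have mu0 : 0 <= mu by rewrite /mu divr_ge0 // ltW.
  have h : M2%:R * (n%:R - 3) <= M * mu * n%:R.
    by rewrite -(ler_pM2r t0) [X in X <= _]mulrAC -(mulrAC _ t) muM.
  have h2 : M * mu <= n%:R * t * n%:R by apply: ler_pM.
  (* The constant 12 comes from [3 n <= 12 (n - 3)], valid for [n >= 4]; the mean adds one more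
     [n]. *)
  have h3 : (M2%:R - M * mu) * (n%:R - 3) <= 12 * (n%:R * t) * (n%:R - 3).
    apply: le_trans (_ : 3 * (n%:R * t * n%:R) <= _); first by lra.
    have : 0 <= n%:R * t by rewrite mulr_ge0 // ltW.
    by move: (n%:R * t) => z z0; nra.
  have h4 : M2%:R - M * mu <= 12 * (n%:R * t) by rewrite -(@ler_pM2r _ (n%:R - 3)) //; lra.
  lra.
have n0 : 0 < n%:R :> R by lra.
rewrite -(ler_pM2r n0); apply: le_trans (le_trans low (le_trans up _)).
  by rewrite le_eqVlt; apply/orP; left; apply/eqP; ring.
by rewrite le_eqVlt; apply/orP; left; apply/eqP; ring.
Qed.

End RealBounds.

(** * Concentration *)

From mathcomp Require Import classical_sets reals topology normedtype sequences.
Import numFieldNormedType.Exports.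

Section Concentration.
Variables (R : realType) (T : finType) (x0 : T) (n : nat).
Hypothesis cardT : #|T| = n.
Notation rooted_trees := (@rooted_trees T x0).
Notation ends := (@ends T x0).

(** The cube root of the comparison [1.37135^30 <= 24^3], checked by repeated squaring with rounding
    up. *)
Lemma dec_pow10 : (dec_1_37135 R) ^+ 10 <= 24.
Proof.
have d0 : 0 <= dec_1_37135 R by rewrite /dec_1_37135; lra.
have d1 : dec_1_37135 R <= 1372 / 1000 by rewrite /dec_1_37135; lra.
move: (dec_1_37135 R) d0 d1 => d d0 d1.
have sq (y b c : R) : 0 <= y -> y <= b -> b * b <= c -> y ^+ 2 <= c.
  by move=> y0 yb cb; rewrite expr2; apply: le_trans cb; apply: ler_pM.
have d2 : d ^+ 2 <= 1883 / 1000 by apply: (sq _ (1372 / 1000)) => //; lra.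
have d4 : d ^+ 2 ^+ 2 <= 3546 / 1000.
  by apply: (sq _ (1883 / 1000)); rewrite ?exprn_ge0 //; lra.
have d8 : d ^+ 2 ^+ 2 ^+ 2 <= 1258 / 100.
  by apply: (sq _ (3546 / 1000)); rewrite ?exprn_ge0 //; lra.
have -> : d ^+ 10 = d ^+ 2 ^+ 2 ^+ 2 * d ^+ 2 by ring.
apply: le_trans (_ : 1258 / 100 * (1883 / 1000) <= _); last by lra.
by apply: ler_pM; rewrite ?exprn_ge0.
Qed.

(* The thresholds are below [1/e], [1/e^2], [1/e^3] and are chosen so that
   [2^11 (3/2)^4 (4/3) = 24^3 >= 1.37135^30]. *)
Lemma subtrees_lower f : f \in rooted_trees ->
  11 / 30 * n%:R <= #|ends f 1|%:R :> R ->
  4 / 30 * n%:R <= #|ends f 2|%:R :> R ->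
  1 / 30 * n%:R <= #|ends f 3|%:R :> R ->
  dec_1_37135 R ^+ n <= #|subtrees (parent_edges x0 f [set: T]%SET)|%:R.
Proof.
move=> fF h1 h2 h3.
have d0 : 0 <= dec_1_37135 R by rewrite /dec_1_37135; lra.
have := leq_mul (card_subtrees fF) (leqnn (2 ^ #|ends f 2| * 3 ^ #|ends f 3|)).
rewrite mulnA => /(leq_trans (card_closed_sets fF)).
move: #|subtrees _| => c.
set N1 := #|ends f 1|; set N2 := #|ends f 2|; set N3 := #|ends f 3|.
rewrite mulnA -(ler_nat R) !natrM !natrX => hc.
have {}hc : 2 ^+ N1 * (3 / 2) ^+ N2 * (4 / 3) ^+ N3 <= c%:R :> R.
  rewrite !expr_div_n mulrA -(@ler_pM2r _ (2 ^+ N2 * 3 ^+ N3)); last first.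
    by rewrite mulr_gt0 // exprn_gt0.
  rewrite [X in _ <= X]mulrA; apply: le_trans hc.
  rewrite le_eqVlt; apply/orP; left; apply/eqP; field.
  by rewrite !expf_neq0 ?pnatr_eq0.
have nat_le (k N : nat) : k%:R / 30 * n%:R <= N%:R :> R -> (k * n <= N * 30)%N.
  by rewrite -(ler_nat R) !natrM => ?; lra.
(* The 30th power clears the denominators of the thresholds. *)
rewrite -(@ler_pXn2r _ 30) // ?nnegrE ?exprn_ge0 //.
apply: le_trans (_ : (2 ^+ N1 * (3 / 2) ^+ N2 * (4 / 3) ^+ N3) ^+ 30 <= _); last first.
  apply: lerXn2r => //; rewrite nnegrE // !mulr_ge0 // exprn_ge0 //; lra.
have exprM3 (x y z : R) k : (x * y * z) ^+ k = x ^+ k * y ^+ k * z ^+ k.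
  by rewrite !exprMn.
rewrite exprM3 -!exprM.
apply: le_trans (_ : 2 ^+ (11 * n) * (3 / 2) ^+ (4 * n) * (4 / 3) ^+ (1 * n) <= _); last first.
  have mono (b : R) (k l : nat) : 1 <= b -> (k <= l)%N -> 0 <= b ^+ k /\ b ^+ k <= b ^+ l.
    by move=> b1 kl; split; [apply: exprn_ge0; lra | apply: ler_weXn2l].
  have [p1 q1] := mono 2 _ _ (ler1n _ 2) (nat_le 11%N N1 h1).
  have [|p2 q2] := mono (3 / 2) _ _ _ (nat_le 4%N N2 h2); first by lra.
  have [|p3 q3] := mono (4 / 3) _ _ _ (nat_le 1%N N3 h3); first by lra.
  apply: ler_pM; [exact: mulr_ge0|exact: p3|exact: ler_pM|exact: q3].
rewrite mulnC !exprM -exprM3; apply: lerXn2r; rewrite ?nnegrE ?exprn_ge0 //.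
  by rewrite !mulr_ge0 ?exprn_ge0 //; lra.
have -> : 2 ^+ 11 * (3 / 2) ^+ 4 * (4 / 3) ^+ 1 = 24 ^+ 3 :> R by field.
rewrite (_ : 30 = 10 * 3)%N // exprM; apply: lerXn2r; rewrite ?nnegrE ?exprn_ge0 //.
exact: dec_pow10.
Qed.

(** The mean of [#|ends f j|] is at least [n ((n - j) / n)^(n - 1)], hence at least [(al + dl) n],
    and [chebyshev_count] applies with gap [dl]. *)
Lemma few_ends_rare (al dl : R) j : (0 < j <= 3)%N ->
  200%:R * 100%:R + 2 <= n%:R :> R -> 0 < dl -> al + dl <= (917 / 2500) ^+ j ->
  #|[set f in rooted_trees | #|ends f j|%:R < al * n%:R]%SET|%:R * (dl ^+ 2 * n%:R)
    <= 13 * #|rooted_trees|%:R.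
Proof.
move=> j3 hn dl0 hal.
have n7 : (7 < n)%N by rewrite -(ltr_nat R); lra.
have /andP[j0 jle3] := j3.
have first := @first_moment T x0 j j0; have second := @second_moment T x0 j j0.
have ct := card_rooted_trees x0.
move: first second ct; rewrite cardT; case: n n7 cardT hn => // a n7 cT hn first second ct.
apply: (chebyshev_count _ _ _ second) => //.
- by apply: leq_trans n7.
- by move=> f _; rewrite -cT; exact: max_card.
- rewrite first; apply: leq_trans (moment_ratio j3 _ ct); last by lia.
  by rewrite leq_mul2l leq_sub2l // orbT.
rewrite first; apply: le_trans (_ : (917 / 2500) ^+ j * (a.+1%:R * #|rooted_trees|%:R) <= _).
  by apply: ler_wpM2r => //; rewrite mulr_ge0.
rewrite -natrM mulnC ct natrX.
apply: le_trans (_ : (a.+1 - j)%:R ^+ a <= _).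
  have := first_moment_ratio j3 hn; rewrite [X in _ <= X]expr_div_n ler_pdivlMr //=.
  by rewrite exprn_gt0.
have ja : (j <= a)%N by lia.
have e : ((a.+1 - j) ^ a = (a.+1 - j) ^ j * (a.+1 - j) ^ (a - j))%N.
  by rewrite -expnD subnKC.
by rewrite -natrX ler_nat e leq_mul2r ffact_ge ?orbT.
Qed.

Lemma labelled_treesE :
  [set parent_edges x0 f [set: T]%SET | f in rooted_trees]%SET =
  [set E | `[< is_tree [set: T]%SET E >]]%SET.
Proof.
apply/setP=> E; rewrite inE; apply/imsetP/asboolP => [[f fF ->]|].
  exact: parent_tree fF (setT_closed _ f).
by move=> /(tree_parent x0)[f fF <-]; exists f.
Qed.

(** A union bound over three bad events, each of probability at most [13 / (dl^2 n)]. *)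
Lemma uniform_prob_lower : 200%:R * 100%:R + 2 <= n%:R :> R ->
  1 - 39 * (100%:R * 100%:R) ^+ 2 / n%:R <=
  uniform_prob R [set E | `[< is_tree [set: T]%SET E >]]%SET
    (fun E => dec_1_37135 R ^+ n <= #|subtrees E|%:R).
Proof.
move=> hn; rewrite /uniform_prob -labelled_treesE.
rewrite card_in_imset; last exact: parent_edges_inj.
set X := rooted_trees; set t : R := #|X|%:R.
have n0 : 0 < n%:R :> R by lra.
(* The tight case is [j = 1], where [917 / 2500] exceeds [11 / 30] by slightly more than
   [1 / 10000]. *)
pose dl : R := (100%:R * 100%:R)^-1.
have dl0 : 0 < dl by rewrite invr_gt0; lra.
pose B j (al : R) := [set f in X | #|ends f j|%:R < al * n%:R]%SET.
pose C : R := 13 * (100%:R * 100%:R) ^+ 2 / n%:R.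
have cB j al : (0 < j <= 3)%N -> al + dl <= (917 / 2500) ^+ j -> #|B j al|%:R <= C * t.
  move=> j3 hal; have := few_ends_rare j3 hn dl0 hal; rewrite -/(B j al) -/X -/t => h.
  have p : 0 < dl ^+ 2 * n%:R by rewrite mulr_gt0 ?exprn_gt0.
  rewrite -(ler_pM2r p); apply: le_trans h _.
  rewrite le_eqVlt; apply/orP; left; apply/eqP; rewrite /C /dl; field.
  by rewrite lt0r_neq0.
pose G := X :\: (B 1 (11 / 30) :|: B 2 (4 / 30) :|: B 3 (1 / 30)).
have t0 : 0 < t.
  rewrite /t ltr0n lt0n; apply/eqP => e; have := card_rooted_trees x0.
  have T0 : (0 < #|T|)%N by apply/card_gt0P; exists x0.
  by rewrite -/X e mul0n => /esym/eqP; rewrite expn_eq0 eqn0Ngt T0.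
have GX : (#|X| <= #|G| + (#|B 1 (11 / 30)| + #|B 2 (4 / 30)| + #|B 3 (1 / 30)|))%N.
  rewrite -(cardsID (B 1 (11 / 30) :|: B 2 (4 / 30) :|: B 3 (1 / 30)) X) addnC leq_add2l.
  apply: leq_trans (subset_leq_card (subsetIr _ _)) _.
  apply: leq_trans (leq_card_setU _ _) _; rewrite leq_add2r; exact: leq_card_setU.
have GP : (#|G| <= #|[set E in [set parent_edges x0 f [set: T]%SET | f in X] |
     (dec_1_37135 R ^+ n <= #|subtrees E|%:R)%R]%SET|)%N.
  have <- : #|[set parent_edges x0 f [set: T]%SET | f in G]%SET| = #|G|.
    rewrite card_in_imset //.
    by move=> f g /setDP[fX _] /setDP[gX _]; apply: parent_edges_inj.
  apply/subset_leq_card/fintype.subsetP=> _ /imsetP[f /setDP[fX] + ->].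
  rewrite !finset.in_setU !negb_or ![_ \in B _ _]finset.in_set fX /= -!leNgt => /andP[/andP[f1 f2] f3].
  rewrite finset.in_set; apply/andP; split; first by apply/imsetP; exists f.
  exact: subtrees_lower.
rewrite ler_pdivlMr //; apply: le_trans (_ : #|G|%:R <= _); last by rewrite ler_nat.
move: GX; rewrite -(ler_nat R) !natrD -/t => GX.
have e1 : (917 / 2500 : R) ^+ 1 = 917 / 2500 by [].
have e2 : (917 / 2500 : R) ^+ 2 = 917 / 2500 * (917 / 2500) by [].
have e3 : (917 / 2500 : R) ^+ 3 = 917 / 2500 * (917 / 2500 * (917 / 2500)) by [].
have b1 : #|B 1 (11 / 30)|%:R <= C * t by apply: cB; rewrite // e1 /dl; lra.
have b2 : #|B 2 (4 / 30)|%:R <= C * t by apply: cB; rewrite // e2 /dl; lra.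
have b3 : #|B 3 (1 / 30)|%:R <= C * t by apply: cB; rewrite // e3 /dl; lra.
have -> : 39 * (100%:R * 100%:R) ^+ 2 / n%:R = 3 * C by rewrite /C; field; rewrite lt0r_neq0.
lra.
Qed.

End Concentration.

Theorem theorem2p1 (R : realType) :
  aas R labelled_trees
    (fun n E => dec_1_37135 R ^+ n <= #|subtrees E|%:R).
Proof.
apply/cvgrPdist_le => e e0; near=> n.
have hn : 200%:R * 100%:R + 2 <= n%:R :> R by near: n; exact: nbhs_infty_ger.
(* This makes the error term of [uniform_prob_lower] at most [e]. *)
have he : 39 * (100%:R * 100%:R) ^+ 2 / e <= n%:R by near: n; exact: nbhs_infty_ger.
have n0 : (0 < n)%N by rewrite -(ltr_nat R); lra.
have nR : 0 < n%:R :> R by rewrite ltr0n.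
have low := uniform_prob_lower (Ordinal n0) (card_ord n) hn.
rewrite -/(labelled_trees n) in low.
have up : uniform_prob R (labelled_trees n)
   (fun E => dec_1_37135 R ^+ n <= #|subtrees E|%:R) <= 1.
  rewrite /uniform_prob; have [->|t0] := posnP #|labelled_trees n|.
    by rewrite invr0 mulr0.
  rewrite ler_pdivrMr ?ltr0n // mul1r ler_nat; apply/subset_leq_card/fintype.subsetP=> E.
  by rewrite inE => /andP[].
rewrite ger0_norm ?subr_ge0 // lerBlDr -lerBlDl; apply: le_trans low.
by rewrite lerD2l lerN2 ler_pdivrMr // [e * _]mulrC -ler_pdivrMr.
Unshelve. all: by end_near.
Qed.
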